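(* Let $\mathcal{A}$ be a unital $C^*$-algebra and $a\in \mathcal{A}$. Then the following inequalities hold: $$v(a) \geq \frac{ \|a\|}{2}+ \frac{\big| \|Re(a)\|- \|Im(a)\| \big|}{2},$$ $$v(a) \geq \frac{\|a\|}{2}+ \frac{\left| \frac{\|a\|}{2}-\|Re(a)\|\right|}{4}+ \frac{\left| \frac{\|a\|}{2}-\|Im(a)\|\right|}{4},$$ $$v(a) \geq \frac{\|a\|}2 + \frac1{2\sqrt{2}} \Big| \| Re(a)+Im(a) \| -\|Re(a)-Im(a)\| \Big| .$$
   Context: $\mathcal{A}$ is a unital $C^*$-algebra with unit $e$. $S(\mathcal{A})$ is the set of normalized states, i.e. continuous linear functionals $f$ on $\mathcal{A}$ with $f(e)=\|f\|=1$. The algebraic numerical radius of $a$ is $v(a)=\sup\{|f(a)|: f\in S(\mathcal{A})\}$. $Re(a)=\frac12(a+a^* )$ and $Im(a)=\frac{1}{2i}(a-a^* )$. *)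

(* Defs.v *)
From HB Require Import structures.
From mathcomp Require Import all_boot all_order all_algebra.
From mathcomp Require Import complex.
From mathcomp Require Import boolp classical_sets reals topology normedtype.

Set Implicit Arguments.
Unset Strict Implicit.
Unset Printing Implicit Defensive.

Import Order.TTheory GRing.Theory Num.Theory.
Import numFieldNormedType.Exports.

Local Open Scope classical_set_scope.
Local Open Scope ring_scope.
Local Open Scope complex_scope.

(* A unital C*-algebra is a complex Banach space with a product, a unit and an
   involution.  The product cannot be inherited from algType: HB rejects any
   structure extending both PzSemiRing and SemiNormedZmodule, as Num.NumDomain
   already is their join. *)
HB.mixin Record isCStarAlgebra (R : realType) A
    & CompleteNormedModule R[i] A := {
  cs_one : A;
  cs_mul : A -> A -> A;
  star : A -> A;
  cs_mulA : associative cs_mul;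
  cs_mul1l : left_id cs_one cs_mul;
  cs_mul1r : right_id cs_one cs_mul;
  cs_mulDl : left_distributive cs_mul +%R;
  cs_mulDr : right_distributive cs_mul +%R;
  cs_scaleAl : forall (c : R[i]) (x y : A),
    c *: cs_mul x y = cs_mul (c *: x) y;
  cs_scaleAr : forall (c : R[i]) (x y : A),
    c *: cs_mul x y = cs_mul x (c *: y);
  cs_ler_normM : forall x y : A, `|cs_mul x y| <= `|x| * `|y|;
  starK : involutive star;
  starD : {morph star : x y / x + y};
  starZ : forall (c : R[i]) (x : A), star (c *: x) = c^*%C *: star x;
  starM : forall x y : A, star (cs_mul x y) = cs_mul (star y) (star x);
  cstar_norm : forall x : A, `|cs_mul (star x) x| = `|x| ^+ 2
}.

#[short(type="cstarAlgType")]
HB.structure Definition CStarAlgebra (R : realType) :=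
  {A of CompleteNormedModule R[i] A & isCStarAlgebra R A}.

(* The library norm of a normed module over R[i] takes its (real, nonnegative)
   values in R[i]; rnorm is the same norm with values in R. *)
Definition rnorm (R : realType) (V : normedZmodType R[i]) (x : V) : R :=
  complex.Re `|x|.

Section Defs.
Variables (R : realType) (A : cstarAlgType R).

Definition re_part (a : A) : A := (2^-1 : R[i]) *: (a + star a).
Definition im_part (a : A) : A := ((2 * 'i%C)^-1 : R[i]) *: (a - star a).

Definition dual_norm (f : {linear A -> R[i]^o}) : R :=
  sup [set rnorm (f x) | x in [set x : A | rnorm x <= 1]].

Definition states : set {linear A -> R[i]^o} :=
  [set f : {linear A -> R[i]^o} |
    [/\ continuous f, f cs_one = 1 & dual_norm f = 1]].

(* The supremum is over a nonempty set bounded by the norm of a, except in the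
   zero algebra, which has no normalized states: there it is sup set0 = 0. *)
Definition numerical_radius (a : A) : R :=
  sup [set rnorm (f a) | f in states].

End Defs.

(* Main.v *)
(** It suffices that [v a >= |Re (c a)|] for every unimodular scalar [c]: the
    three inequalities then follow from the triangle inequality applied to the
    Cartesian decompositions of [a] and of [(1 - i) a].

    States are hermitian, so this reduces to finding, for a self-adjoint [h], a
    state [f] with [|f h| = |h|].  Up to replacing [h] by [-h] one has
    [|h + t 1| = |h| + t] for all [t >= 0]; this rests only on square roots of
    [c 1 - y] for [|y| < c] (a fixed point argument) and on the inequality
    [|x|^2 <= |x^2 + y^2|] for commuting self-adjoint [x] and [y], so no spectral
    theory is involved.  The norm is then tilted into a smaller sublinear
    functional whose value at [h] is still [|h|], and any linear functional below
    it is the real part of the required state. *)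

From HB Require Import structures.
Require Import Defs.
From mathcomp Require Import all_boot all_order all_algebra.
From mathcomp Require Import complex.
From mathcomp Require Import boolp classical_sets reals topology normedtype.
From mathcomp Require Import ring lra sequences.

Set Implicit Arguments.
Unset Strict Implicit.
Unset Printing Implicit Defensive.

Import Order.TTheory GRing.Theory Num.Theory.
Import numFieldNormedType.Exports.
Local Open Scope classical_set_scope.
Local Open Scope ring_scope.

(** * The Hahn-Banach theorem *)

Section HahnBanach.
Variables (R : realType) (V : lmodType R).
Implicit Types (p q : V -> R) (x y : V).

Definition sublinear p :=
  (forall x y, p (x + y) <= p x + p y) /\
  (forall r x, 0 <= r -> p (r *: x) <= r * p x).

Lemma sublinear0 p : sublinear p -> p 0 = 0.
Proof.
move=> [pD pZ]; have := pZ 0 0 (lexx _); have := pD 0 0.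
by rewrite scale0r addr0; lra.
Qed.

Lemma sublinear_geN p x : sublinear p -> - p (- x) <= p x.
Proof.
move=> sp; have := sublinear0 sp; case: sp => pD _.
by have := pD x (- x); rewrite subrr; lra.
Qed.

Lemma sublinearZ p r x : sublinear p -> 0 <= r -> p (r *: x) = r * p x.
Proof.
move=> sp; rewrite le_eqVlt => /predU1P[<-|r0].
  by rewrite scale0r mul0r sublinear0.
apply/le_anti/andP; split; first exact/sp.2/ltW.
have := sp.2 r^-1 (r *: x); rewrite invr_ge0 ltW// => /(_ isT).
by rewrite scalerA mulVf ?gt_eqF// scale1r mulrC ler_pdivlMr// mulrC.
Qed.

(* The largest sublinear functional below [p] whose value at [- y] is at most
   [- p y]. *)
Definition tilt p y x : R :=
  inf [set p (x + t *: y) - t * p y | t in [set t | 0 <= t]].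

Let tilt_set p y x : set R :=
  [set p (x + t *: y) - t * p y | t in [set t | 0 <= t]].

Let tilt_nonempty p y x : tilt_set p y x !=set0.
Proof. by exists (p (x + 0 *: y) - 0 * p y), 0 => /=. Qed.

Let tilt_has_lbound p y x : sublinear p -> has_lbound (tilt_set p y x).
Proof.
(* The infimum is finite because [t * p y = p (t *: y) <= p (x + t *: y) + p (- x)]. *)
move=> sp; exists (- p (- x)) => _ [t /= t0 <-].
have := sp.1 (x + t *: y) (- x).
by rewrite addrAC subrr add0r (sublinearZ _ sp t0); lra.
Qed.

Lemma tilt_le p y x t : sublinear p -> 0 <= t ->
  tilt p y x <= p (x + t *: y) - t * p y.
Proof. by move=> sp t0; apply: ge_inf; [exact: tilt_has_lbound|exists t]. Qed.

Lemma tilt_le_id p y x : sublinear p -> tilt p y x <= p x.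
Proof.
move=> sp; have := tilt_le y x sp (lexx 0).
by rewrite scale0r addr0 mul0r subr0.
Qed.

Lemma sublinear_tilt p y : sublinear p -> sublinear (tilt p y).
Proof.
move=> sp; split=> [x x'|r x].
  rewrite -lerBlDr;
    apply: (@lb_le_inf _ _ _ (@tilt_nonempty _ _ _)) => _ [t /= t0 <-].
  rewrite lerBlDr -lerBlDl;
    apply: (@lb_le_inf _ _ _ (@tilt_nonempty _ _ _)) => _ [s /= s0 <-].
  (* The parameters [s] at [x'] and [t] at [x] merge into [s + t] at the sum. *)
  rewrite lerBlDl; apply: le_trans (tilt_le _ _ sp (addr_ge0 s0 t0)) _.
  by have := sp.1 (x' + s *: y) (x + t *: y);
    rewrite addrACA -scalerDl [x' + x]addrC; lra.
rewrite le_eqVlt => /predU1P[<-|r0].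
  by rewrite scale0r mul0r -(sublinear0 sp) tilt_le_id.
rewrite mulrC -ler_pdivrMr//;
    apply: (@lb_le_inf _ _ _ (@tilt_nonempty _ _ _)) => _ [t /= t0 <-].
rewrite ler_pdivrMr//.
apply: le_trans (tilt_le _ _ sp (mulr_ge0 (ltW r0) t0)) _.
by rewrite -scalerA -scalerDr (sublinearZ _ sp (ltW r0)); lra.
Qed.

(** For [q] evaluated at [x] and [q'] at [y], the smaller of the two functionals bounds both values,
    so its own subadditivity suffices. The infima are finite since
    [- p (- x) <= - q (- x) <= q x]. *)
Lemma sublinear_inf_chain p (Q : set (V -> R)) : Q !=set0 ->
  (forall q, Q q -> sublinear q /\ forall x, q x <= p x) ->
  (forall q q', Q q -> Q q' ->
     (forall x, q x <= q' x) \/ (forall x, q' x <= q x)) ->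
  sublinear (fun x => inf [set q x | q in Q]) /\
  (forall q x, Q q -> inf [set q x | q in Q] <= q x).
Proof.
move=> [q0 Qq0] Qp Qtot.
have inf_le q x : Q q -> inf [set q x | q in Q] <= q x.
  move=> Qq; apply: ge_inf; last by exists q.
  exists (- p (- x)) => _ [q' /Qp[sq' q'p] <-].
  by apply: le_trans (sublinear_geN x sq'); rewrite lerN2.
have nonempty x : [set q x | q in Q] !=set0 by exists (q0 x), q0.
split=> //; split=> [x y|r x].
  rewrite -lerBlDr; apply: (lb_le_inf (nonempty _)) => _ [q Qq <-].
  rewrite lerBlDr -lerBlDl; apply: (lb_le_inf (nonempty _)) => _ [q' Qq' <-].
  rewrite lerBlDl.
  have [qq'|q'q] := Qtot _ _ Qq Qq'.
    have := (Qp _ Qq).1.1 x y; have := inf_le _ (x + y) Qq; have := qq' y; lra.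
  have := (Qp _ Qq').1.1 x y; have := inf_le _ (x + y) Qq'; have := q'q x; lra.
rewrite le_eqVlt => /predU1P[<-|r0].
  rewrite scale0r mul0r; apply: le_trans (inf_le _ _ Qq0) _.
  by rewrite sublinear0//; case: (Qp _ Qq0).
rewrite mulrC -ler_pdivrMr//; apply: (lb_le_inf (nonempty _)) => _ [q Qq <-].
rewrite ler_pdivrMr// mulrC; apply: le_trans (inf_le _ _ Qq) _.
exact/(Qp _ Qq).1.2/ltW.
Qed.

(** Zorn's lemma for the reversed pointwise order: a nonempty chain is bounded by its infimum, the
    empty one by [p]. *)
Lemma sublinear_minimal p : sublinear p ->
  exists q, [/\ sublinear q, forall x, q x <= p x &
    forall q', sublinear q' -> (forall x, q' x <= q x) -> q' = q].
Proof.
move=> sp; pose T := {q : V -> R | sublinear q /\ forall x, q x <= p x}.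
pose below (s t : T) := `[< forall x, sval t x <= sval s x >].
have [||||[q [sq qp]] qmin] := @Zorn T below.
- by move=> t; exact/asboolP.
- move=> r s t /asboolP rs /asboolP st; apply/asboolP => x.
  exact: le_trans (st x) (rs x).
- move=> [s Ps] [t Pt] /asboolP/= ts /asboolP/= st; apply: eq_exist.
  by apply/funext => x; apply/le_anti; rewrite ts st.
- move=> A Atot; have [->|/set0P[a Aa]] := eqVneq A set0.
    by exists (exist _ p (conj sp (fun x => lexx (p x)))) => s.
  have [|||sQ leQ] := @sublinear_inf_chain p [set sval s | s in A].
  + by exists (sval a), a.
  + by move=> _ [s _ <-]; exact: (svalP s).
  + move=> _ _ [s As <-] [t At <-].
    by have [/asboolP|/asboolP] := Atot _ _ As At; [right|left].
  have leA s x : A s -> inf [set q x | q in [set sval s | s in A]] <= sval s x.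
    by move=> As; apply: leQ; exists s.
  have Qp x : inf [set q x | q in [set sval s | s in A]] <= p x.
    by apply: le_trans (leA _ _ Aa) _; exact: (svalP a).2.
  exists (exist _ (fun x => inf _) (conj sQ Qp)) => s As; apply/asboolP => x /=.
  exact: leA.
exists q; split=> // q' sq' q'q.
have Pq' : sublinear q' /\ forall x, q' x <= p x.
  by split=> // x; exact: le_trans (q'q x) (qp x).
by have /(congr1 sval) := qmin (exist _ q' Pq') (asboolT q'q).
Qed.

(* A minimal sublinear functional is unchanged by tilting in any direction, and
   is therefore linear. *)
Lemma hahn_banach p y : sublinear p ->
  exists phi : V -> R, [/\ scalar phi, forall x, phi x <= p x & phi y = p y].
Proof.
(* Taking [q] below [tilt p y], and not merely below [p], forces [q (- y) <= - p y]. *)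
move=> sp; have [q [sq qp qmin]] := sublinear_minimal (sublinear_tilt y sp).
have qD x z : q (x + z) = q x + q z.
  apply/le_anti; rewrite sq.1/=.
  (* As [q] equals its tilt along [z], the parameter 1 gives superadditivity:
     [q x <= q (x + z) - q z]. *)
  have tq := qmin _ (sublinear_tilt z sq) (fun x => tilt_le_id z x sq).
  by have := tilt_le z x sq ler01; rewrite tq scale1r mul1r; lra.
have qN x : q (- x) = - q x.
  by have := qD x (- x); rewrite subrr (sublinear0 sq); lra.
have qZ r x : q (r *: x) = r * q x.
  have [r0|/ltW r0] := leP 0 r; first exact: sublinearZ.
  have Nr0 : 0 <= - r by rewrite oppr_ge0.
  by rewrite -[r in LHS]opprK scaleNr qN (sublinearZ _ sq Nr0) mulNr opprK.
exists q; split=> [a x z|x|].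
- by rewrite qD qZ.
- by apply: le_trans (qp x) _; exact: tilt_le_id.
- apply/le_anti; rewrite (le_trans (qp y) (tilt_le_id _ _ sp))/=.
  have := le_trans (qp (- y)) (tilt_le y (- y) sp ler01).
  by rewrite scale1r addNr (sublinear0 sp) qN mul1r sub0r lerN2.
Qed.

End HahnBanach.

(** * Norms and contractions in complex Banach spaces *)

Section Rnorm.
Variables (R : realType) (V : normedModType R[i]).
Implicit Types (x y : V).

Lemma rnormE x : `|x| = (rnorm x)%:C%C.
Proof. by rewrite /rnorm RRe_real// realE normr_ge0. Qed.

Lemma rnorm_ge0 x : 0 <= rnorm x.
Proof. by rewrite -ler0c -rnormE. Qed.

Lemma rnorm0 : rnorm (0 : V) = 0.
Proof. by rewrite /rnorm normr0. Qed.

Lemma rnorm0_eq0 x : rnorm x = 0 -> x = 0.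
Proof. by move=> x0; apply/eqP; rewrite -normr_eq0 rnormE x0. Qed.

Lemma rnormD x y : rnorm (x + y) <= rnorm x + rnorm y.
Proof. by rewrite -lecR rmorphD/= -!rnormE ler_normD. Qed.

Lemma rnormN x : rnorm (- x) = rnorm x.
Proof. by rewrite /rnorm normrN. Qed.

Lemma rnormB x y : rnorm (x - y) = rnorm (y - x).
Proof. by rewrite -rnormN opprB. Qed.

Lemma rnormZ (c : R[i]) x : rnorm (c *: x) = rnorm c * rnorm x.
Proof.
by apply: (@complexI R); rewrite rmorphM/= -!rnormE normrZ; congr (_ * _);
  rewrite /rnorm RRe_real// realE normr_ge0.
Qed.

Lemma rnorm_real (r : R) : rnorm r%:C%C = `|r|.
Proof. by rewrite /rnorm normc_def/= expr0n addr0 sqrtr_sqr. Qed.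

Lemma rnormZr (r : R) x : rnorm (r%:C%C *: x) = `|r| * rnorm x.
Proof. by rewrite rnormZ rnorm_real. Qed.

End Rnorm.

Section Contraction.
Variables (R : realType) (V : completeNormedModType R[i]).
Variables (P : V -> Prop) (F : V -> V) (q : R) (x0 : V).
Hypotheses (q0 : 0 <= q) (q1 : q < 1) (Px0 : P x0).
Hypothesis PF : forall x, P x -> P (F x).
Hypothesis lipF :
  forall x y, P x -> P y -> rnorm (F x - F y) <= q * rnorm (x - y).
Hypothesis closedP :
  forall l, (forall e, 0 < e -> exists2 x, P x & rnorm (x - l) < e) -> P l.

Let u n := iter n F x0.
Let C := rnorm (F x0 - x0) / (1 - q).

Let C_ge0 : 0 <= C.
Proof. by rewrite divr_ge0 ?rnorm_ge0// subr_ge0 ltW. Qed.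

Let Pu n : P (u n). Proof. by elim: n => //= n; exact: PF. Qed.

Let u_step n : rnorm (u n.+1 - u n) <= q ^+ n * (C * (1 - q)).
Proof.
rewrite /C divfK; last by rewrite gt_eqF// subr_gt0.
elim: n => [|n ih]; first by rewrite expr0 mul1r.
apply: le_trans (lipF (Pu n.+1) (Pu n)) _.
by rewrite exprS -mulrA ler_wpM2l.
Qed.

(** The steps from [n] to [n + m] add up to a geometric sum; keeping its closed form makes the
    induction close. *)
Let u_dist n m : rnorm (u (n + m)%N - u n) <= q ^+ n * C * (1 - q ^+ m).
Proof.
elim: m => [|m ih]; first by rewrite addn0 !subrr rnorm0 mulr0.
rewrite addnS -(subrK (u (n + m)%N) (u (n + m).+1)) -addrA.
apply: le_trans (rnormD _ _) _; apply: le_trans (lerD (u_step _) ih) _.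
by rewrite exprD exprS; lra.
Qed.

Let u_cauchy e : 0 < e ->
  exists N, forall n, (N <= n)%N -> rnorm (u n - u N) < e.
Proof.
move=> e0; have : (fun n => q ^+ n * C) @ \oo --> (0 * C : R).
  by apply: cvgMl; apply: cvg_expr; rewrite ger0_norm.
rewrite mul0r => /cvgrPdist_lt/(_ e e0)[N _ NP]; exists N => n Nn.
rewrite -(subnKC Nn); apply: le_lt_trans (u_dist _ _) _.
have := NP N (leqnn N); rewrite /= sub0r normrN ger0_norm; last first.
  by rewrite mulr_ge0// exprn_ge0.
apply: le_lt_trans; apply: ler_piMr; last by rewrite gerBl exprn_ge0.
by apply: mulr_ge0 => //; exact: exprn_ge0.
Qed.

(** Banach's fixed point theorem on the closed invariant set [P], so that the fixed point inherits
    every property collected in [P]. *)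
Lemma contraction_fixpoint : exists2 l, P l & F l = l.
Proof.
have cu : cvgn u.
  apply/cauchy_cvgP/cauchy_exP => e e0.
  (* The radius is a positive element of [R[i]], hence real, and the estimates in [R] apply. *)
  have eE : e = (complex.Re e)%:C%C by rewrite RRe_real// realE ltW.
  rewrite eE ltcR in e0 *; have [N uN] := u_cauchy e0.
  exists (u N), N => // n /= Nn; rewrite -ball_normE /= rnormE ltcR rnormB.
  exact: uN.
pose l := limn u.
have ul e : 0 < e -> exists N, forall n, (N <= n)%N -> rnorm (u n - l) < e.
  move=> e0; have /cvgrPdist_lt/(_ e%:C%C)[|N _ NP] := cu.
    by rewrite ltcR.
  by exists N => n Nn; rewrite rnormB -ltcR -rnormE; exact: NP.
have Pl : P l.
  by apply: closedP => e /ul[N Ne]; exists (u N) => //; exact: Ne.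
exists l => //; apply/eqP; rewrite -subr_eq0; apply/eqP/rnorm0_eq0/eqP.
rewrite eq_le rnorm_ge0 andbT; apply/ler_addgt0Pr => e e0; rewrite add0r.
have [N uN] := ul (e / 2) (divr_gt0 e0 (ltr0n _ 2)).
rewrite -(subrK (u N.+1) (F l)) -addrA; apply: le_trans (rnormD _ _) _.
rewrite [e]splitr lerD ?(ltW (uN _ (leqnSn _)))//.
apply: le_trans (lipF Pl (Pu N)) _; rewrite rnormB.
apply: le_trans (ltW (uN _ (leqnn _))).
by rewrite ler_piMl ?rnorm_ge0// ltW.
Qed.

End Contraction.

(** * Self-adjoint elements *)

Lemma conjc_i (R : realType) : ('i%C : R[i])^*%C = - 'i%C.
Proof. by apply/eqP; rewrite eq_complex /= oppr0 !eqxx. Qed.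

Lemma subrACA (V : zmodType) (a b c d : V) : a - b - (c - d) = a - c - (b - d).
Proof. by rewrite !opprB [d - c]addrC addrACA [- b + d]addrC. Qed.

Section CStarAlgebra.
Variables (R : realType) (A : cstarAlgType R).
Implicit Types (x y z h w : A) (r s t c : R).

Local Notation "x ** y" := (cs_mul x y) (at level 40, left associativity).
Local Notation e := (@cs_one R A).
Local Notation "r *.: x" := (r%:C%C *: x) (at level 40).

Lemma cs_mulNl x y : (- x) ** y = - (x ** y).
Proof. by rewrite -scaleN1r -cs_scaleAl scaleN1r. Qed.

Lemma cs_mulNr x y : x ** (- y) = - (x ** y).
Proof. by rewrite -scaleN1r -cs_scaleAr scaleN1r. Qed.

Lemma cs_mulBl x y z : (x - y) ** z = x ** z - y ** z.
Proof. by rewrite cs_mulDl cs_mulNl. Qed.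

Lemma cs_mulBr x y z : x ** (y - z) = x ** y - x ** z.
Proof. by rewrite cs_mulDr cs_mulNr. Qed.

Lemma cs_mul0l x : 0 ** x = 0.
Proof. by rewrite -(subrr x) cs_mulBl !subrr. Qed.

Lemma cs_mul0r x : x ** 0 = 0.
Proof. by rewrite -(subrr x) cs_mulBr !subrr. Qed.

Lemma star1 : star e = e.
Proof. by rewrite -[LHS]cs_mul1r -{2}[e]starK -starM cs_mul1r starK. Qed.

Lemma star0 : star (0 : A) = 0.
Proof. by have := starZ 0 (0 : A); rewrite conjc0 !scale0r. Qed.

Lemma starN x : star (- x) = - star x.
Proof. by apply/eqP; rewrite -addr_eq0 -starD addNr star0. Qed.

Lemma starB x y : star (x - y) = star x - star y.
Proof. by rewrite starD starN. Qed.

Lemma starZr r x : star (r *.: x) = r *.: star x.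
Proof. by rewrite starZ conjc_real. Qed.

Lemma rnormM x y : rnorm (x ** y) <= rnorm x * rnorm y.
Proof. by rewrite -lecR rmorphM/= -!rnormE cs_ler_normM. Qed.

Lemma rnorm_star_mul x : rnorm (star x ** x) = rnorm x ^+ 2.
Proof. by apply: (@complexI R); rewrite rmorphXn/= -!rnormE cstar_norm. Qed.

(** The C*-identity gives [|y|^2 = |y^* y| <= |y^*| |y|]; apply this to [x] and to [star x]. *)
Lemma rnorm_star x : rnorm (star x) = rnorm x.
Proof.
suff le_star y : rnorm y <= rnorm (star y).
  by apply/le_anti; rewrite -{2}[x]starK !le_star.
have := rnormM (star y) y; rewrite rnorm_star_mul expr2.
have := rnorm_ge0 y; rewrite le_eqVlt => /predU1P[<- _|y0].
  exact: rnorm_ge0.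
by rewrite ler_pM2r.
Qed.

Lemma rnorm_unit : e != 0 -> rnorm e = 1.
Proof.
move=> e0; have := rnorm_star_mul e; rewrite star1 cs_mul1l expr2 => ee.
have e_neq0 : rnorm e != 0 by apply: contra e0 => /eqP/rnorm0_eq0 ->.
by apply: (mulfI e_neq0); rewrite mulr1.
Qed.

Lemma rnorm_sqr h : star h = h -> rnorm (h ** h) = rnorm h ^+ 2.
Proof. by move=> sh; rewrite -{1}sh rnorm_star_mul. Qed.

Lemma scale_halfD x : 2^-1 *.: (x + x) = x.
Proof. by rewrite scalerDr -scalerDl -rmorphD -[2^-1]div1r -splitr scale1r. Qed.

Lemma rnorm_halfD x y M : rnorm x <= M -> rnorm y <= M ->
  rnorm (2^-1 *.: (x + y)) <= M.
Proof.
move=> xM yM; rewrite rnormZr ger0_norm ?invr_ge0// mulrC ler_pdivrMr//.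
by apply: le_trans (rnormD _ _) _; lra.
Qed.

(* With [z = x + iy], which is normal, [x^2 + y^2 = z^* z], and [x] is the real
   part of [z]. *)
Lemma rnorm_sqr_le_sum x y : star x = x -> star y = y -> x ** y = y ** x ->
  rnorm x ^+ 2 <= rnorm (x ** x + y ** y).
Proof.
move=> sx sy xy; pose z := x + 'i%C *: y.
have sz : star z = x - 'i%C *: y by rewrite starD starZ sx sy conjc_i scaleNr.
have -> : x ** x + y ** y = star z ** z.
  rewrite sz cs_mulBl !cs_mulDr -!cs_scaleAl -!cs_scaleAr scalerA.
  by rewrite -expr2 sqr_i scaleN1r xy opprD opprK addrA addrK.
rewrite rnorm_star_mul ler_sqr ?nnegrE ?rnorm_ge0//.
have -> : x = 2^-1 *.: (star z + z).
  by rewrite sz addrACA addNr addr0 scale_halfD.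
by apply: rnorm_halfD; rewrite ?rnorm_star.
Qed.

Definition comm x y := x ** y = y ** x.

Lemma commD z x y : comm z x -> comm z y -> comm z (x + y).
Proof. by rewrite /comm cs_mulDl cs_mulDr => -> ->. Qed.

Lemma commB z x y : comm z x -> comm z y -> comm z (x - y).
Proof. by rewrite /comm cs_mulBl cs_mulBr => -> ->. Qed.

Lemma commM z x y : comm z x -> comm z y -> comm z (x ** y).
Proof.
by rewrite /comm cs_mulA => ->; rewrite -cs_mulA => ->; rewrite cs_mulA.
Qed.

Lemma commZ z (a : R[i]) x : comm z x -> comm z (a *: x).
Proof. by rewrite /comm -cs_scaleAl -cs_scaleAr => ->. Qed.

Lemma comm1 z : comm z e.
Proof. by rewrite /comm cs_mul1l cs_mul1r. Qed.

(** This carries self-adjointness and commutation relations over to limits, each being written as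
    the vanishing of a bounded additive map. *)
Lemma closed_additive_kernel (T : A -> A) (K : R) l :
  (forall x y, T (x - y) = T x - T y) ->
  (forall x, rnorm (T x) <= K * rnorm x) ->
  (forall d, 0 < d -> exists2 x, T x = 0 & rnorm (x - l) < d) -> T l = 0.
Proof.
move=> TB TK Tl.
have K1 : 0 < `|K| + 1 by rewrite ltr_wpDl.
apply/rnorm0_eq0/eqP; rewrite eq_le rnorm_ge0 andbT.
apply/ler_addgt0Pr => d d0; rewrite add0r.
have [x Tx0 xl] := Tl _ (divr_gt0 d0 K1).
rewrite -rnormN -sub0r -Tx0 -TB; apply: le_trans (TK _) _.
move: xl; rewrite ltr_pdivlMr// mulrC => /ltW; apply: le_trans.
by rewrite ler_wpM2r ?rnorm_ge0// (le_trans (ler_norm K))// lerDl.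
Qed.

(* [1 - u] is the fixed point of the contraction [y |-> (w + y^2) / 2]. *)
Lemma sqrt_one_minus w : star w = w -> rnorm w < 1 ->
  exists u, [/\ star u = u, forall z, comm z w -> comm z u & u ** u = e - w].
Proof.
move=> sw w1; pose F y := 2^-1 *.: (w + y ** y).
(* On the ball of radius [|w| < 1] the map [F] contracts with constant [|w|]; the other two clauses
   are what the limit must retain. *)
pose P y := [/\ rnorm y <= rnorm w, star y = y &
  forall z, comm z w -> comm z y].
have w0 := rnorm_ge0 w.
have [|y [x1 sx1 cx1]|x y [xw _ _] [yw _ _]|l Pl|l [lw sl cl] Fl] :=
    @contraction_fixpoint R A P F (rnorm w) 0 w0 w1.
- split; rewrite ?rnorm0 ?star0//.
  by move=> z _; rewrite /comm cs_mul0l cs_mul0r.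
- split.
  + apply: rnorm_halfD => //; apply: le_trans (rnormM _ _) _.
    by have := rnorm_ge0 y; nra.
  + by rewrite starZr starD starM sw sx1.
  + by move=> z zw; apply: commZ; apply: commD => //; apply: commM; exact: cx1.
(* Each of the two summands has norm at most [|w| |x - y|], and the factor 1/2 averages them. *)
- have -> : F x - F y = 2^-1 *.: (x ** (x - y) + (x - y) ** y).
    rewrite -scalerBr cs_mulBl cs_mulBr addrA subrK.
    by rewrite opprD addrACA subrr add0r.
  apply: rnorm_halfD; apply: le_trans (rnormM _ _) _.
    by rewrite ler_wpM2r ?rnorm_ge0.
  by rewrite mulrC ler_wpM2r ?rnorm_ge0.
- split.
  + apply/ler_addgt0Pr => d /Pl[x [xw _ _] xl].
    rewrite -(subrK x l) addrC; apply: le_trans (rnormD _ _) _.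
    by rewrite lerD// rnormB ltW.
  + apply/eqP; rewrite -subr_eq0; apply/eqP.
    apply: (@closed_additive_kernel (fun x => star x - x) 2).
    * by move=> x y; rewrite starB subrACA.
    * move=> x; apply: le_trans (rnormD _ _) _.
      by rewrite rnormN rnorm_star; lra.
    * by move=> d /Pl[x [_ sx _] xl]; exists x => //; rewrite sx subrr.
  + move=> z zw; apply/eqP; rewrite -subr_eq0; apply/eqP.
    apply: (@closed_additive_kernel (fun x => z ** x - x ** z) (2 * rnorm z)).
    * by move=> x y; rewrite cs_mulBl cs_mulBr subrACA.
    * move=> x; apply: le_trans (rnormD _ _) _; rewrite rnormN.
      by have := rnormM z x; have := rnormM x z; lra.
    * by move=> d /Pl[x [_ _ cx] xl]; exists x => //; rewrite cx// subrr.
- exists (e - l); split.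
  + by rewrite starB star1 sl.
  + by move=> z zw; apply: commB; [exact: comm1|exact: cl].
  (* The fixed point equation reads [l^2 = 2 l - w], whence [(1 - l)^2 = 1 - w]. *)
  + have ll : l ** l = l + l - w.
      by rewrite -[X in X + X]Fl -scalerDr scale_halfD addrC addKr.
    rewrite cs_mulBl !cs_mulBr !cs_mul1l cs_mul1r ll opprB.
    by rewrite [l + l - w - l]addrAC addrK addrA subrK.
Qed.

(** Rescaling of the previous square root, by [c - y = c (1 - y / c)]. *)
Lemma sqrt_scalar_minus c y : star y = y -> rnorm y < c ->
  exists u, [/\ star u = u, forall z, comm z y -> comm z u &
    u ** u = c *.: e - y].
Proof.
move=> sy yc; have c0 : 0 < c := le_lt_trans (rnorm_ge0 y) yc.
have [|| u [su cu uu]] := @sqrt_one_minus (c^-1 *.: y).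
- by rewrite starZr sy.
- by rewrite rnormZr ger0_norm ?invr_ge0 ?ltW// mulrC ltr_pdivrMr// mul1r.
exists (Num.sqrt c *.: u); split.
- by rewrite starZr su.
- by move=> z zy; apply/commZ/cu/commZ.
- rewrite -cs_scaleAl -cs_scaleAr scalerA -rmorphM -expr2 sqr_sqrtr ?ltW//.
  by rewrite uu scalerBr scalerA -rmorphM mulfV ?gt_eqF// scale1r.
Qed.

(* If both norms were smaller, [eta - h] and [eta + h] would have commuting
   square roots [u] and [v] for some [eta < |h|], whence
   [h^2 + (u v)^2 = eta^2] and [|h| <= eta]. *)
Lemma rnorm_addr_scalar h : e != 0 -> star h = h ->
  (forall t, 0 <= t -> rnorm (h + t *.: e) = rnorm h + t) \/
  (forall t, 0 <= t -> rnorm (- h + t *.: e) = rnorm h + t).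
Proof.
move=> e0 sh.
have rt t : 0 <= t -> rnorm (t *.: e) = t.
  by move=> t0; rewrite rnormZr rnorm_unit// mulr1 ger0_norm.
apply: contrapT => /not_orP[/existsNP[s /not_implyP[s0 /eqP hs]]].
move=> /existsNP[t /not_implyP[t0 /eqP ht]].
have {}hs : rnorm (h + s *.: e) < rnorm h + s.
  by rewrite lt_neqAle hs -{2}(rt s s0) rnormD.
have {}ht : rnorm (- h + t *.: e) < rnorm h + t.
  by rewrite lt_neqAle ht -{2}(rt t t0) -(rnormN h) rnormD.
(* Indeed [s <= |h + s| + |h| < 2 |h| + s]. *)
have h0 : 0 < rnorm h.
  have := rnormD (h + s *.: e) (- h).
  by rewrite addrAC subrr add0r rt// rnormN; lra.
(* Any [eta] strictly between [b] and [|h|] is positive and satisfies [|h + s| < eta + s] and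
   [|- h + t| < eta + t]. *)
pose b := Num.max 0 (Num.max (rnorm (h + s *.: e) - s)
                             (rnorm (- h + t *.: e) - t)).
have bh : b < rnorm h by rewrite !gt_max h0/=; apply/andP; split; lra.
pose eta := (b + rnorm h) / 2.
have beta : b < eta by rewrite /eta; lra.
have etah : eta < rnorm h by rewrite /eta; lra.
move: beta; rewrite !gt_max => /and3P[eta0 etas etat].
have [||u [su cu uu]] := @sqrt_scalar_minus (eta + s) (h + s *.: e).
- by rewrite starD starZr sh star1.
- lra.
have [||v [sv cv vv]] := @sqrt_scalar_minus (eta + t) (- h + t *.: e).
- by rewrite starD starN starZr sh star1.
- lra.
have hu : comm h u.
  by apply: cu; apply: commD => //; apply/commZ/comm1.
have hN z : comm z h -> comm z (- h + t *.: e).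
  move=> zh; apply: commD; last exact/commZ/comm1.
  by rewrite -scaleN1r; exact: commZ.
have hv : comm h v by apply/cv/hN.
(* [v] commutes with [h], hence with the element whose root defines [u], hence with [u]. *)
have vu : comm v u.
  apply: cu; apply: commD; last exact/commZ/comm1.
  by rewrite /comm hv.
have {}uu : u ** u = eta *.: e - h.
  by rewrite uu rmorphD scalerDl opprD addrACA subrr addr0.
have {}vv : v ** v = eta *.: e + h.
  by rewrite vv rmorphD scalerDl opprD opprK addrACA
    subrr addr0.
have := @rnorm_sqr_le_sum h (u ** v) sh.
rewrite starM su sv vu => /(_ erefl (commM hu hv)).
have -> : u ** v ** (u ** v) = (eta ^+ 2) *.: e - h ** h.
  rewrite -cs_mulA (cs_mulA v) vu -(cs_mulA u v v) cs_mulA uu vv.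
  rewrite cs_mulBl !cs_mulDr -!cs_scaleAl -!cs_scaleAr cs_mul1l cs_mul1r.
  by rewrite cs_mul1l scalerA -rmorphM -expr2 opprD addrA addrK.
rewrite addrC subrK rt ?sqr_ge0// => hle; have := h0; nra.
Qed.

End CStarAlgebra.

(** * States *)

(** Restriction of scalars to [R]; the separate name keeps the real module structure apart from the
    complex one. *)
Definition realified (R : realType) (V : lmodType R[i]) : Type := V.

Section Realified.
Variables (R : realType) (V : lmodType R[i]).

HB.instance Definition _ := GRing.Zmodule.on (realified V).

Let rscale (r : R) (x : realified V) : realified V := r%:C%C *: (x : V).

Let rscaleA r s x : rscale r (rscale s x) = rscale (r * s) x.
Proof. by rewrite /rscale scalerA rmorphM. Qed.

Let rscale1 : left_id 1 rscale.
Proof. by move=> x; rewrite /rscale rmorph1 scale1r. Qed.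

Let rscaleDr : right_distributive rscale +%R.
Proof. by move=> r x y; rewrite /rscale scalerDr. Qed.

Let rscaleDl x : {morph rscale^~ x : r s / r + s}.
Proof. by move=> r s; rewrite /rscale rmorphD scalerDl. Qed.

HB.instance Definition _ := GRing.Zmodule_isLmodule.Build R (realified V)
  rscaleA rscale1 rscaleDr rscaleDl.

Lemma realifiedZ (r : R) (x : V) : r *: (x : realified V) = r%:C%C *: x.
Proof. by []. Qed.

End Realified.

Lemma rnorm_complex_sqr (R : realType) (z : R[i]) :
  rnorm (z : R[i]^o) ^+ 2 = complex.Re z ^+ 2 + complex.Im z ^+ 2.
Proof.
by rewrite /rnorm normc_def/= sqr_sqrtr// addr_ge0// sqr_ge0.
Qed.

Lemma Re_le_rnorm (R : realType) (z : R[i]) :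
  complex.Re z <= rnorm (z : R[i]^o).
Proof.
rewrite -lecR -rnormE; apply: le_trans (normc_ge_Re z).
by rewrite lecR ler_norm.
Qed.

Section Complexification.
Variables (R : realType) (A : cstarAlgType R) (phi : realified A -> R).
Hypotheses (phi_lin : scalar phi) (phi_le : forall x : A, phi x <= rnorm x).

Let phiD (x y : A) : phi (x + y) = phi x + phi y.
Proof. by have := phi_lin 1 x y; rewrite scale1r mul1r. Qed.

Let phiZ (r : R) (x : A) : phi (r%:C%C *: x) = r * phi x.
Proof.
have phi0 : phi 0 = 0 by have := phiD 0 0; rewrite addr0; lra.
by have := phi_lin r x 0; rewrite !addr0 phi0 addr0.
Qed.

(** The unique complex linear functional with real part [phi], namely [phi x - i phi (i x)]. *)
Definition complexify (x : A) : R[i]^o :=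
  Complex (phi x) (- phi ('i%C *: x)).

Let complexify_linear : linear complexify.
Proof.
move=> [u v] x y; apply/eqP; rewrite eq_complex; apply/andP => /=.
have aE : Complex u v *: x = u%:C%C *: x + v%:C%C *: ('i%C *: x).
  by rewrite scalerA -scalerDl; congr (_ *: _); apply/eqP;
    rewrite eq_complex /= !mul0r !mulr0 mulr1 ?subr0 ?add0r ?addr0 !eqxx.
have iaE : 'i%C *: (Complex u v *: x) = u%:C%C *: ('i%C *: x) + (- v)%:C%C *: x.
  by rewrite !scalerA -scalerDl; congr (_ *: _); apply/eqP;
    rewrite eq_complex /=; apply/andP; split; apply/eqP; ring.
by rewrite scalerDr iaE aE !phiD !phiZ; split; apply/eqP; ring.
Qed.

HB.instance Definition _ :=
  GRing.isLinear.Build R[i] A R[i]^o *:%R complexify complexify_linear.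

(** For [z] the value at [x], rotating by the conjugate of [z] makes the value real:
    [|z|^2 = phi (z^* x) <= |z| |x|]. *)
Lemma complexify_le (x : A) : rnorm (complexify x) <= rnorm x.
Proof.
pose z := complexify x.
have zz : rnorm z ^+ 2 = phi (z^*%C *: x).
  have -> : phi (z^*%C *: x) = complex.Re (complexify (z^*%C *: x)) by [].
  by rewrite linearZ/= rnorm_complex_sqr /z /=; ring.
have := phi_le (z^*%C *: x); rewrite -zz rnormZ.
have -> : rnorm (z^*%C : R[i]) = rnorm z by rewrite /rnorm normcJ.
have := rnorm_ge0 z; rewrite le_eqVlt => /predU1P[<- _|z0].
  exact: rnorm_ge0.
by rewrite expr2 ler_pM2l.
Qed.

(** A value at the unit of modulus at most 1 and real part at least 1 must be 1. The dual norm is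
    then attained at the unit. *)
Lemma exists_state_Re : rnorm (cs_one : A) = 1 -> 1 <= phi cs_one ->
  exists2 f : {linear A -> R[i]^o}, states f &
    forall x, complex.Re (f x) = phi x.
Proof.
move=> e1 phi1; have fle := complexify_le.
have f1 : complexify cs_one = 1.
  have := fle cs_one; rewrite e1 => ne.
  have := rnorm_complex_sqr (complexify cs_one).
  have : rnorm (complexify cs_one) ^+ 2 <= 1.
    by rewrite expr_le1// rnorm_ge0.
  rewrite /complexify /= => n1 n2; apply/eqP; rewrite eq_complex /=.
  by apply/andP; split; apply/eqP; nra.
exists complexify => //; split=> //.
- move=> x; apply/cvgrPdist_lt => d d0; near=> y.
  rewrite -linearB/=; apply: le_lt_trans (_ : `|x - y| < d).
    by rewrite !rnormE lecR; exact: fle.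
  by near: y; apply: cvgr_dist_lt.
- have ub :
    ubound [set rnorm (complexify x) | x in [set x : A | rnorm x <= 1]] 1.
    by move=> _ [x /= x1 <-]; exact: le_trans (fle x) x1.
  have in1 : [set rnorm (complexify x) | x in [set x : A | rnorm x <= 1]] 1.
    exists cs_one => /=; first by rewrite e1.
    by rewrite f1 /rnorm normr1.
  apply/le_anti/andP; split; first by apply: ge_sup => //; exists 1.
  by apply: ub_le_sup => //; exists 1.
Unshelve. all: by end_near.
Qed.

End Complexification.

Section States.
Variables (R : realType) (A : cstarAlgType R).
Implicit Types (a x y h k : A) (f : {linear A -> R[i]^o}) (r t u v : R).

Local Notation e := (@cs_one R A).

(** The norm is tilted along the unit: this forces [phi (- e) <= -1], hence [1 <= phi e], while the
    value at [h] stays [|h|]. *)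
Lemma exists_state_ge h : e != 0 -> star h = h ->
  exists2 f, states f & rnorm h <= rnorm (f h).
Proof.
move=> e0.
wlog hD : h / forall t, 0 <= t -> rnorm (h + t%:C%C *: e) = rnorm h + t.
  move=> wl sh; have [hD|hD] := rnorm_addr_scalar e0 sh; first exact: wl.
  have [||f sf fh] := wl (- h).
  - by move=> t t0; rewrite hD// rnormN.
  - by rewrite starN sh.
  by exists f => //; move: fh; rewrite linearN !rnormN.
move=> sh; pose p (x : realified A) := rnorm (x : A).
have sp : sublinear p.
  split=> [x y|r x r0]; first exact: rnormD.
  by rewrite /p realifiedZ rnormZr ger0_norm.
have p1 : p e = 1 by exact: rnorm_unit.
have st := sublinear_tilt (e : realified A) sp.
have [phi [phi_lin phi_le phi_h]] := hahn_banach (h : realified A) st.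
have phi_le_rnorm (x : A) : phi x <= rnorm x.
  by apply: le_trans (phi_le x) _; exact: tilt_le_id.
have phi_e : 1 <= phi e.
  have := le_trans (phi_le (- e)) (tilt_le (e : realified A) (- e) sp ler01).
  rewrite scale1r addNr (sublinear0 sp) p1 mulr1 sub0r.
  have phi0 : phi 0 = 0 by have := phi_lin 1 0 0; rewrite scale1r addr0; lra.
  by have := phi_lin (-1) e 0; rewrite scaleN1r !addr0 phi0; lra.
have [f sf fE] := exists_state_Re phi_lin phi_le_rnorm (rnorm_unit e0) phi_e.
exists f => //.
(* By [hD] every term of the infimum defining the tilt at [h] equals [|h|]. *)
have <- : phi h = rnorm h.
  apply/le_anti; rewrite phi_le_rnorm phi_h.
  apply: lb_le_inf => [|_ [t /= t0 <-]].
    by exists (p (h + 0 *: (e : realified A)) - 0 * p e), 0 => /=.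
  by rewrite /p realifiedZ hD// rnorm_unit// mulr1 addrK.
by rewrite -fE Re_le_rnorm.
Qed.

Lemma state_le f x : states f -> rnorm (f x) <= rnorm x.
Proof.
move=> [_ _ f1].
have le1 y : rnorm y <= 1 -> rnorm (f y) <= 1.
  move=> y1; rewrite -f1; apply: ub_le_sup; last by exists y.
  (* Were the set unbounded, [sup] would take its default value 0, against [dual_norm f = 1]. *)
  apply: contrapT => nub; move: f1; rewrite /dual_norm sup_out; last first.
    by move=> [].
  by move/eqP; rewrite eq_sym oner_eq0.
have [x0|x0] := eqVneq (rnorm x) 0.
  by rewrite (rnorm0_eq0 x0) linear0 !rnorm0.
have xgt0 : 0 < rnorm x by rewrite lt_neqAle eq_sym x0 rnorm_ge0.
have := le1 ((rnorm x)^-1%:C%C *: x).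
rewrite linearZ/= !rnormZr ger0_norm ?invr_ge0 ?rnorm_ge0// mulVf//.
by move=> /(_ (lexx _)); rewrite mulrC ler_pdivrMr// mul1r.
Qed.

(* [|f (h + i t)|^2 <= |h + i t|^2 <= |h|^2 + t^2] for all real [t]; the
   left-hand side contains the term [2 t Im (f h)]. *)
Lemma state_selfadjoint f h : states f -> star h = h -> complex.Im (f h) = 0.
Proof.
move=> sf sh; have [_ fe _] := sf.
have bound t : (complex.Im (f h) + t) ^+ 2 <= rnorm h ^+ 2 + t ^+ 2.
  pose x := h + 'i%C *: (t%:C%C *: e).
  have : rnorm (f x) ^+ 2 <= rnorm x ^+ 2.
    by rewrite ler_sqr ?nnegrE ?rnorm_ge0//; exact: state_le.
  rewrite linearD !linearZ/= fe rnorm_complex_sqr -rnorm_star_mul.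
  have -> : cs_mul (star x) x = cs_mul h h + (t ^+ 2)%:C%C *: e.
    rewrite /x starD starZ starZr sh star1 conjc_i scaleNr cs_mulBl !cs_mulDr.
    rewrite -!cs_scaleAl -!cs_scaleAr cs_mul1l cs_mul1r cs_mul1l opprD addrA.
    rewrite addrK !scalerA -mulrA mulrACA -!expr2 sqr_i.
    by rewrite mulN1r scaleNr opprK rmorphXn.
  have := rnormD (cs_mul h h) ((t ^+ 2)%:C%C *: e).
  rewrite rnorm_sqr// rnormZr ger0_norm ?sqr_ge0//.
  have e1 : rnorm e <= 1.
    have [->|/rnorm_unit ->//] := eqVneq e 0; by rewrite rnorm0.
  have : t ^+ 2 * rnorm e <= t ^+ 2 by rewrite ler_piMr ?sqr_ge0.
  case: (f h) => al be /=; rewrite !mul0r !mul1r !mulr1 !mulr0 subr0 ?add0r.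
  have := sqr_ge0 al; nra.
set be := complex.Im (f h) in bound *; apply/eqP; apply: contrapT => /negP be0.
(* With this [t] the bound becomes [be^2 + 2 |h|^2 <= |h|^2], which is absurd for nonzero [be]. *)
have := bound (rnorm h ^+ 2 / be).
have : be * (rnorm h ^+ 2 / be) = rnorm h ^+ 2 by rewrite mulrC divfK.
have : 0 < be ^+ 2 by rewrite exprn_even_gt0.
by have := sqr_ge0 (rnorm h); nra.
Qed.

(** * Cartesian decomposition *)

Lemma halfC : (2^-1 : R[i]) = (2^-1)%:C%C.
Proof. by rewrite fmorphV rmorph_nat. Qed.

Lemma re_part_selfadjoint a : star (re_part a) = re_part a.
Proof. by rewrite /re_part halfC starZr starD starK addrC. Qed.

Lemma im_partE a : im_part a = - ('i%C *: ((2^-1)%:C%C *: (a - star a))).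
Proof.
rewrite /im_part scalerA -scaleNr; congr (_ *: _); rewrite invfM halfC mulrC.
by rewrite -mulNr; congr (_ * _); apply: (@mulfI _ 'i%C);
  rewrite ?divff ?mulrN -?expr2 ?sqr_i ?opprK ?eq_complex//= oner_eq0 andbF.
Qed.

Lemma im_part_selfadjoint a : star (im_part a) = im_part a.
Proof.
rewrite im_partE starN starZ starZr starB starK conjc_i scaleNr.
by rewrite -[star a - a]opprB !scalerN opprK.
Qed.

Lemma cartesian a : a = re_part a + 'i%C *: im_part a.
Proof.
rewrite im_partE scalerN !scalerA mulrA -expr2 sqr_i mulN1r scaleNr opprK.
by rewrite /re_part halfC -scalerDr addrACA subrr addr0 scale_halfD.
Qed.

Lemma re_part_cartesian x y : star x = x -> star y = y ->
  re_part (x + 'i%C *: y) = x.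
Proof.
move=> sx sy; rewrite /re_part starD starZ sx sy conjc_i scaleNr addrACA subrr.
by rewrite addr0 halfC scale_halfD.
Qed.

Lemma scale_cartesian u v a : Complex u v *: a =
  (u%:C%C *: re_part a - v%:C%C *: im_part a) +
  'i%C *: (v%:C%C *: re_part a + u%:C%C *: im_part a).
Proof.
have -> : Complex u v = u%:C%C + 'i%C * v%:C%C.
  by rewrite {1}[Complex u v]complexE.
rewrite {1}[a]cartesian; move: (re_part a) (im_part a) => x y.
rewrite scalerDl !scalerDr !scalerA.
rewrite ['i%C * _ * 'i%C]mulrAC -expr2 sqr_i mulN1r scaleNr.
rewrite [_ - v%:C%C *: _]addrC addrACA [u%:C%C * _]mulrC; congr (_ + _).
exact: addrC.
Qed.

Lemma re_part_scale u v a :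
  re_part (Complex u v *: a) = u%:C%C *: re_part a - v%:C%C *: im_part a.
Proof.
rewrite scale_cartesian re_part_cartesian// ?starB ?starD !starZr.
  by rewrite re_part_selfadjoint im_part_selfadjoint.
by rewrite re_part_selfadjoint im_part_selfadjoint.
Qed.

(** * Lower bounds for the numerical radius *)

Lemma rnorm_le_numerical_radius f a :
  states f -> rnorm (f a) <= numerical_radius a.
Proof.
move=> sf; apply: ub_le_sup; last by exists f.
by exists (rnorm a) => _ [g /= sg <-]; exact: state_le.
Qed.

(** Take a state [f] norming the real part of [b = c a]. It is real on both Cartesian parts of [b],
    so [|f (re_part b)| = |Re (f b)| <= |f b| = |f a|]. *)
Lemma numerical_radius_ge_re_part (c : R[i]) a : rnorm (c : R[i]^o) = 1 ->
  rnorm (re_part (c *: a)) <= numerical_radius a.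
Proof.
move=> c1; set b := c *: a.
(* In the zero algebra there are no states, and both sides are 0. *)
have [e0|e0] := eqVneq e 0.
  have A0 x : x = 0 by rewrite -[x]cs_mul1l e0 cs_mul0l.
  have no_state f : ~ states f.
    by move=> [_ fe _]; move/eqP: fe; rewrite e0 linear0 eq_sym oner_eq0.
  rewrite (A0 (re_part b)) rnorm0 /numerical_radius.
  suff -> : [set rnorm (f a) | f in states (A:=A)] = set0 by rewrite sup0.
  by apply/seteqP; split=> // z [f sf _]; case: (no_state f).
have [f sf fh] := exists_state_ge e0 (re_part_selfadjoint b).
apply: le_trans fh (le_trans _ (rnorm_le_numerical_radius a sf)).
have <- : rnorm (f b) = rnorm (f a) by rewrite linearZ/= rnormZ c1 mul1r.
have -> : f b = f (re_part b) + 'i%C * f (im_part b).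
  by rewrite {1}[b]cartesian linearD [in LHS](linearZ _ (im_part b)).
rewrite -ler_sqr ?nnegrE ?rnorm_ge0// !rnorm_complex_sqr.
have := state_selfadjoint sf (re_part_selfadjoint b).
have := state_selfadjoint sf (im_part_selfadjoint b).
move: (f (re_part b)) (f (im_part b)) => [r1 i1] [r2 i2] /= -> ->.
by nra.
Qed.

(** The left side is the norm of the real part of [(u + i v) a]; dividing by the modulus makes the
    scalar unimodular, and [u = v = 0] is treated apart. *)
Lemma numerical_radius_ge_scale u v a :
  rnorm (u%:C%C *: re_part a - v%:C%C *: im_part a) <=
  Num.sqrt (u ^+ 2 + v ^+ 2) * numerical_radius a.
Proof.
have := sqrtr_ge0 (u ^+ 2 + v ^+ 2).
set n := Num.sqrt _; have nE : n ^+ 2 = u ^+ 2 + v ^+ 2.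
  by rewrite sqr_sqrtr ?addr_ge0 ?sqr_ge0.
rewrite le_eqVlt => /predU1P[n0|n0].
  have u0 : u = 0 by rewrite -n0 in nE; nra.
  have v0 : v = 0 by rewrite -n0 in nE; nra.
  by rewrite u0 v0 !scale0r subr0 rnorm0 -n0 mul0r.
have c1 : rnorm (Complex (u / n) (v / n) : R[i]^o) = 1.
  apply/eqP; rewrite -(@eqrXn2 _ 2)// ?rnorm_ge0// rnorm_complex_sqr expr1n /=.
  by rewrite !expr_div_n -mulrDl -nE divff// expf_neq0// gt_eqF.
have := numerical_radius_ge_re_part a c1; rewrite re_part_scale => le_nr.
rewrite mulrC -ler_pdivrMr//; apply: le_trans le_nr.
rewrite !rmorphM /= ![_ * (n^-1)%:C%C]mulrC -!scalerA -scalerBr rnormZr.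
by rewrite gtr0_norm ?invr_gt0// mulrC.
Qed.

Lemma rnorm_im_le x y : rnorm (x + 'i%C *: y) <= rnorm x + rnorm y.
Proof.
apply: le_trans (rnormD _ _) _; rewrite rnormZ.
suff -> : rnorm ('i%C : R[i]) = 1 by rewrite mul1r.
by rewrite /rnorm normc_def /= expr0n expr1n add0r sqrtr1.
Qed.

End States.

Theorem theorem2p1 (R : realType) (A : cstarAlgType R) (a : A) :
  [/\ numerical_radius a >=
        rnorm a / 2 + `|rnorm (re_part a) - rnorm (im_part a)| / 2,
      numerical_radius a >=
        rnorm a / 2 + `|rnorm a / 2 - rnorm (re_part a)| / 4
                    + `|rnorm a / 2 - rnorm (im_part a)| / 4
    & numerical_radius a >=
        rnorm a / 2 + 1 / (2 * Num.sqrt 2) *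
          `|rnorm (re_part a + im_part a) - rnorm (re_part a - im_part a)|].
Proof.
have a_le : rnorm a <= rnorm (re_part a) + rnorm (im_part a).
  by rewrite {1}[a]cartesian rnorm_im_le.
have re_le : rnorm (re_part a) <= numerical_radius a.
  have := numerical_radius_ge_scale 1 0 a.
  by rewrite !scale1r scale0r subr0 expr1n expr0n addr0 sqrtr1 mul1r.
have im_le : rnorm (im_part a) <= numerical_radius a.
  have := numerical_radius_ge_scale 0 1 a.
  by rewrite !scale1r scale0r sub0r rnormN expr1n expr0n add0r sqrtr1 mul1r.
have sum_le : rnorm (re_part a + im_part a) <= Num.sqrt 2 * numerical_radius a.
  have := numerical_radius_ge_scale 1 (-1) a.
  by rewrite rmorphN scaleN1r opprK scale1r sqrrN expr1n -[1 + 1]/2.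
have diff_le : rnorm (re_part a - im_part a) <= Num.sqrt 2 * numerical_radius a.
  have := numerical_radius_ge_scale 1 1 a.
  by rewrite !scale1r expr1n -[1 + 1]/2.
(* Triangle inequality for [(1 - i) a], whose Cartesian parts are [re_part a + im_part a] and
   [im_part a - re_part a]. *)
have sqrt2_le : Num.sqrt 2 * rnorm a <=
    rnorm (re_part a + im_part a) + rnorm (re_part a - im_part a).
  have <- : rnorm (Complex 1 (-1) *: a) = Num.sqrt 2 * rnorm a.
    by rewrite rnormZ /rnorm normc_def /= sqrrN expr1n -[1 + 1]/2.
  rewrite scale_cartesian rmorphN !scale1r !scaleN1r opprK.
  by apply: le_trans (rnorm_im_le _ _) _; rewrite [- _ + _]addrC rnormB.
have s0 : 0 < Num.sqrt 2 :> R by rewrite sqrtr_gt0.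
split.
(* The maximum of two numbers is half their sum plus half their distance; the sum is at least
   [|a|]. *)
- by case: (ger0P (rnorm (re_part a) - rnorm (im_part a))) => *; lra.
(* If one part falls short of [|a| / 2], the other exceeds it by at least as much; so both distances
   are at most [numerical_radius a - |a| / 2]. *)
- case: (ger0P (rnorm a / 2 - rnorm (re_part a))) => *;
  case: (ger0P (rnorm a / 2 - rnorm (im_part a))) => *; lra.
- set p := rnorm (_ + _) in sum_le sqrt2_le *.
  set q := rnorm (_ - _) in diff_le sqrt2_le *.
  (* After multiplication by the square root of 2, the maximum argument applies to [p] and [q]. *)
  rewrite -(ler_pM2l s0) mulrDr.
  have -> : Num.sqrt 2 * (1 / (2 * Num.sqrt 2) * `|p - q|) = `|p - q| / 2.
    by field; rewrite gt_eqF.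
  by case: (ger0P (p - q)) => *; lra.
Qed.
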